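(* Let $G$ be a tree on $n\ge 2$ vertices and let $k=|D(G)|/2$. Then $$\lambda_2(G)\ \ge\ \frac{n-k+1-\sqrt{(n-k+1)^2-4(n-2k)}}{2}.$$
   Context: The Laplacian of a finite simple graph on $n$ vertices is $L=\Delta-A$, where $\Delta$ is the diagonal matrix of degrees and $A$ is the adjacency matrix; its eigenvalues are listed as $0=\lambda_1(G)\le\lambda_2(G)\le\cdots\le\lambda_n(G)$ with multiplicity. $d(x,v)$ denotes graph distance and $D(G)=\{v\in V(G): \text{there is some } x\in V(G)\text{ with } d(x,v)\ge 3\}$. *)

(* Defs.v *)
From HB Require Import structures.
From mathcomp Require Import all_boot all_order all_algebra.
From mathcomp Require Import polyrcf.

Set Implicit Arguments.
Unset Strict Implicit.
Unset Printing Implicit Defensive.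

Import Order.TTheory GRing.Theory Num.Theory.
Local Open Scope ring_scope.

Section Graph.
Variables (T : finType) (e : rel T).

Definition simple_graph := symmetric e /\ irreflexive e.

Definition connected_graph := forall x y : T, connect e x y.

(* [ucycleb] accepts [::] and [:: x; y] (one edge traversed back and forth):
   genuine graph cycles have at least 3 vertices. *)
Definition acyclic_graph := forall c : seq T, (2 < size c)%N -> ~~ ucycleb e c.

Definition tree := [/\ simple_graph, connected_graph & acyclic_graph].

Definition walk_of_length (l : nat) (x y : T) : bool :=
  [exists p : l.-tuple T, path e x p && (last x p == y)].

(* The least length of a walk from x to y. A shortest walk repeats no vertex,
   so its length is less than #|T|; the value is #|T| for disconnected pairs. *)
Definition dist (x y : T) : nat :=
  find (fun l => walk_of_length l x y) (iota 0 #|T|).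

Definition Dset : {set T} := [set v | [exists x, (3 <= dist x v)%N]].

Definition degree (x : T) : nat := #|[set y | e x y]|.

Variable R : rcfType.

Definition adjacency_mx : 'M[R]_#|T| :=
  \matrix_(i, j) (e (enum_val i) (enum_val j))%:R.

Definition degree_mx : 'M[R]_#|T| :=
  diag_mx (\row_i (degree (enum_val i))%:R).

Definition laplacian : 'M[R]_#|T| := degree_mx - adjacency_mx.

End Graph.

(* The roots in R of the characteristic polynomial, in nondecreasing order
   ([rootsR] is increasing), each repeated according to its multiplicity. *)
Definition eigenvalues (R : rcfType) (n : nat) (A : 'M[R]_n) : seq R :=
  flatten [seq nseq (mup x (char_poly A)) x | x <- rootsR (char_poly A)].

(* Indexed from 1: [lambda e R 1] is the smallest Laplacian eigenvalue. *)
Definition lambda (T : finType) (e : rel T) (R : rcfType) (i : nat) : R :=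
  (eigenvalues (laplacian e R))`_i.-1.

(* Main.v *)
Require Import Defs.
From HB Require Import structures.
From mathcomp Require Import all_boot all_order all_algebra.
From mathcomp Require Import polyrcf complex.
From mathcomp Require Import ring lra.

(* Vertices outside D(G) are within distance 2 of every vertex, so unless
   D(G) = V(G), in which case the bound is 0, the tree can be rooted at some
   c outside D(G) and then has depth at most 2.  Write s = |V \ D| = n - 2k; the
   bound is the smaller root of f(y) = y^2 - ((n + s)/2 + 1) y + s, so it
   suffices to find t <= lambda_2 with f(t) <= 0.  A number t is at most lambda_2
   as soon as the Dirichlet form dominates t |x|^2 on some hyperplane.
   Minimising over the leaves, a child v of c with a_v children contributes
   (x_v - x_c)^2 - g_v x_v^2 with g_v = t + a_v t/(1 - t).  If all g_v <= 1, the
   hyperplane x_c = 0 works; otherwise a single child v1 has g_v1 > 1, and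
   x_c = (1 - g_v1) x_v1 works.  For s <= 1 take t^2 - (n + 3)/2 t + 1 = 0;
   otherwise the tree is a star (t = 1) or a double star, where s <= 2 and
   t^2 - (n/2 + 2) t + 2 = 0. *)

Set Implicit Arguments.
Unset Strict Implicit.
Unset Printing Implicit Defensive.

Import Order.TTheory GRing.Theory Num.Theory.
Local Open Scope ring_scope.

(** * A Courant-Fischer bound for the second eigenvalue *)

Lemma char_poly_similar (A : comNzRingType) n (P Q M : 'M[A]_n) :
  Q *m P = 1%:M -> char_poly (Q *m M *m P) = char_poly M.
Proof.
move=> QP1; rewrite /char_poly /char_poly_mx.
pose p := map_mx polyC P; pose q := map_mx polyC Q.
have qp1 : q *m p = 1%:M by rewrite -map_mxM QP1 map_mx1.
have -> : 'X%:M - map_mx polyC (Q *m M *m P) =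
          q *m ('X%:M - map_mx polyC M) *m p.
  rewrite !map_mxM mulmxBr mulmxBl; congr (_ - _).
  by rewrite scalar_mxC -mulmxA qp1 mulmx1.
by rewrite !det_mulmx mulrC mulrA -det_mulmx (mulmx1C qp1) det1 mul1r.
Qed.

Section Spectral.
Local Open Scope sesquilinear_scope.
Variable R : rcfType.
Local Notation rc := (real_complex R).

(** A real symmetric matrix is Hermitian over [R[i]], so the complex spectral theorem applies. Its
    eigenvalues are real, which lets [d] descend to [R] while [U] stays complex. *)
Lemma symmetric_spectral n (A : 'M[R]_n) : A^T = A ->
  exists d : 'rV[R]_n, exists2 U : 'M[R[i]]_n, U \is unitarymx &
    map_mx rc A = U^t* *m diag_mx (map_mx rc d) *m U.
Proof.
move=> symA; set AC := map_mx rc A.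
have hermA : AC \is hermsymmx.
  apply: realsym_hermsym.
    apply/is_hermitianmxP; rewrite expr0 scale1r map_mx_id //.
    by apply/matrixP => i j; rewrite !mxE -[in LHS]symA mxE.
  by apply/mxOverP => i j; rewrite mxE complex_real.
have /hermitian_normalmx/orthomx_spectralP := hermA.
have := hermitian_spectral_diag_real hermA.
set d := spectral_diag _; set U := spectralmx _ => dR eA.
exists (map_mx (@complex.Re R) d); exists U; first exact: spectral_unitarymx.
have -> : map_mx rc (map_mx (@complex.Re R) d) = d.
  by apply/matrixP => i j; rewrite !mxE; apply: RRe_real; apply/mxOverP.
by rewrite -invmx_unitary ?spectral_unitarymx.
Qed.

Lemma char_poly_spectral n (A : 'M[R]_n) (d : 'rV[R]_n) (U : 'M[R[i]]_n) :
    U \is unitarymx -> map_mx rc A = U^t* *m diag_mx (map_mx rc d) *m U ->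
  char_poly A = \prod_(x <- [seq d 0 i | i : 'I_n]) ('X - x%:P).
Proof.
move=> uU eA; apply: (map_poly_inj rc).
rewrite map_char_poly /= eA char_poly_similar; last first.
  by rewrite -invmx_unitary // mulVmx // unitarymx_unit.
rewrite char_poly_trig ?diag_mx_is_trig // big_map big_enum /= rmorph_prod.
apply: eq_bigr => i _; rewrite /= map_polyXsubC !mxE eqxx mulr1n //.
Qed.

(** Both lists contain [x] as often as its multiplicity as a root of the characteristic
    polynomial. *)
Lemma eigenvalues_perm n (A : 'M[R]_n) (s : seq R) :
  char_poly A = \prod_(x <- s) ('X - x%:P) -> perm_eq (eigenvalues A) s.
Proof.
move=> eA; apply/allP => x _ /=; apply/eqP.
rewrite -(mu_prod_XsubC x s) -eA /eigenvalues.
have p0 : char_poly A != 0 by rewrite monic_neq0 ?char_poly_monic.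
have rP := roots_onP (roots_on_rootsR p0).
rewrite count_flatten -map_comp.
under eq_map => y do rewrite /= count_nseq /=.
have [xr|xnr] := boolP (x \in rootsR (char_poly A)); last first.
  rewrite mupNroot; last first.
    by apply: contra xnr; rewrite rP ?in_itv.
  rewrite (_ : map _ _ = [seq 0%N | y <- rootsR (char_poly A)]).
    by elim: (rootsR _) => //= a l ->.
  apply/eq_in_map => y yr; case: eqP => [eyx|]; last by rewrite mul0n.
  by rewrite -eyx yr in xnr.
have ur : uniq (rootsR (char_poly A)) by apply: uniq_roots.
rewrite sumnE big_map (bigD1_seq x) //= eqxx mul1n big1 ?addn0 // => y yx.
by rewrite (negPf yx) mul0n.
Qed.

Lemma eigenvalues_sorted n (A : 'M[R]_n) : sorted <=%R (eigenvalues A).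
Proof.
rewrite /eigenvalues.
have : sorted <%R (rootsR (char_poly A)) by apply: sorted_roots.
rewrite lt_sorted_pairwise le_sorted_pairwise.
elim: (rootsR _) => //= x l IH /andP[/allP xl pl].
rewrite pairwise_cat IH // andbT; apply/andP; split.
  apply/allrelP => y z; rewrite mem_nseq => /andP[_ /eqP->].
  case/flattenP => _ /mapP[u ul ->]; rewrite mem_nseq => /andP[_ /eqP->].
  exact/ltW/xl.
by elim: (mup x _) => //= k ->; rewrite andbT all_nseq lexx orbT.
Qed.

Local Notation quad M u := ((u *m M *m u ^t*) 0 0).

(* By symmetry of A the cross terms of u = a + i b cancel. *)
Lemma quad_real n (A : 'M[R]_n) (u : 'rV[R[i]]_n) : A^T = A ->
  let a := map_mx (@complex.Re R) u in let b := map_mx (@complex.Im R) u in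
  quad (map_mx rc A) u = rc ((a *m A *m a^T) 0 0 + (b *m A *m b^T) 0 0).
Proof.
move=> symA a b.
have -> : u = map_mx rc a + 'i *: map_mx rc b.
  by apply/matrixP => i j; rewrite !mxE -complexE.
set a' := map_mx rc a; set b' := map_mx rc b; set A' := map_mx rc A.
have symA' : A'^T = A' by rewrite /A' map_trmx symA.
have -> : (a' + 'i *: b') ^t* = a'^T - 'i *: b'^T.
  apply/matrixP => k l; rewrite !mxE rmorphD rmorphM /= conjCi mulNr.
  by rewrite !conj_Creal // complex_real.
have ab : a' *m A' *m b'^T = b' *m A' *m a'^T.
  rewrite -[LHS]trmxK [X in _ = X]mx11_scalar [X in X^T]mx11_scalar tr_scalar_mx.
  congr (_ 0 0)%:M.
  by rewrite !trmx_mul trmxK symA' mulmxA.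
have -> : (a' + 'i *: b') *m A' *m (a'^T - 'i *: b'^T) =
          a' *m A' *m a'^T + b' *m A' *m b'^T.
  rewrite mulmxBr !mulmxDl -!scalemxAr -!scalemxAl ab scalerA.
  by rewrite -expr2 sqrCi scaleN1r opprD opprK addrA addrK.
rewrite /a' /b' /A' !map_trmx -!map_mxM -map_mxD.
by rewrite [LHS]mxE mxE.
Qed.

(** Otherwise two eigenvectors with eigenvalues below t span a plane. It meets the hyperplane in a
    nonzero complex [u] whose form is less than t |u|^2, against the bounds for its real and
    imaginary parts. *)
Lemma second_eigenvalue_ge n (A : 'M[R]_n) (w : 'cV[R]_n) (t : R) :
    (1 < n)%N -> A^T = A ->
    (forall x : 'rV_n, x *m w = 0 ->
       t * (x *m x^T) 0 0 <= (x *m A *m x^T) 0 0) ->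
  t <= (eigenvalues A)`_1.
Proof.
move=> n1 symA tP; have [d [U uU eA]] := symmetric_spectral symA.
have pe := eigenvalues_perm (char_poly_spectral uU eA).
have se : size (eigenvalues A) = n.
  by rewrite (perm_size pe) size_map size_enum_ord.
rewrite leNgt; apply/negP => lt1.
have : (1 < count (< t) (eigenvalues A))%N.
  move: (eigenvalues_sorted A) lt1; move: se n1.
  case: (eigenvalues A) => [|x [|y s]] /=; try by move=> <-.
  by move=> _ _ /andP[xy _] yt; rewrite yt (le_lt_trans xy yt).
rewrite (permP pe) count_map.
have -> : count (preim (fun i => d 0 i) (< t)) (enum 'I_n) =
          #|[pred i | d 0 i < t]|.
  by rewrite cardE [in RHS]/enum_mem size_filter enumT.
case/card_gt1P => i [j [/= dit djt ij]].
pose wC := map_mx rc w.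
pose f k := (row k U *m wC) 0 0.
(* The plane spanned by the rows i and j of U meets the hyperplane. *)
have [al [be [abw ab0]]] :
    exists al be, al * f i + be * f j = 0 /\ (al != 0) || (be != 0).
  have [fi0|fi0] := eqVneq (f i) 0; last first.
    by exists (f j), (- f i); rewrite oppr_eq0 fi0 orbT mulNr mulrC subrr.
  by exists 1, 0; rewrite fi0 mulr0 mul0r addr0 oner_eq0.
pose u : 'rV[R[i]]_n := al *: row i U + be *: row j U.
pose y : 'rV[R[i]]_n := al *: delta_mx 0 i + be *: delta_mx 0 j.
have uy : u = y *m U by rewrite mulmxDl -!scalemxAl -!rowE.
have quad_diag (g : 'rV[R]_n) :
   quad (U^t* *m diag_mx (map_mx rc g) *m U) u
     = rc (g 0 i) * `|al| ^+ 2 + rc (g 0 j) * `|be| ^+ 2.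
  have UK : U *m U^t* = 1%:M by apply/unitarymxP.
  rewrite uy trmx_mul map_mxM !mulmxA -[y *m U *m _]mulmxA UK mulmx1.
  rewrite -[_ *m U *m _]mulmxA UK mulmx1 mul_mx_diag !mxE.
  rewrite (bigD1 i) //= (bigD1 j) ?[j == i]eq_sym //= big1 => [|k /andP[ki kj]].
    rewrite !mxE !eqxx (negPf ij) [j == i]eq_sym (negPf ij) /=.
    by rewrite !normCK; ring.
  by rewrite !mxE (negPf ki) (negPf kj) /= !mulr0 addr0 !mul0r.
have uw : u *m wC = 0.
  rewrite [LHS]mx11_scalar mulmxDl -!scalemxAl mxE [X in X + _]mxE.
  by rewrite [X in _ + X]mxE abw raddf0.
have quadA := quad_diag d; rewrite -eA in quadA.
have quad1 : quad 1%:M u = `|al| ^+ 2 + `|be| ^+ 2.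
  have := quad_diag (const_mx 1); rewrite [const_mx 1 0 i]mxE [const_mx 1 0 j]mxE.
  rewrite map_const_mx diag_const_mx rmorph1 !mul1r mulmx1.
  by rewrite -invmx_unitary // mulVmx // unitarymx_unit.
have lt : quad (map_mx rc A) u < rc t * quad (1%:M) u.
  rewrite quadA quad1 -subr_gt0.
  rewrite (_ : _ - _ = rc (t - d 0 i) * `|al| ^+ 2 + rc (t - d 0 j) * `|be| ^+ 2).
    have pi : 0 < rc (t - d 0 i) by rewrite ltcR subr_gt0.
    have pj : 0 < rc (t - d 0 j) by rewrite ltcR subr_gt0.
    have [al0|be0] := orP ab0.
      by rewrite ltr_wpDr ?mulr_ge0 ?exprn_ge0 ?pmulr_rgt0 ?exprn_gt0 ?normr_gt0 // ltW.
    by rewrite ltr_wpDl ?mulr_ge0 ?exprn_ge0 ?pmulr_rgt0 ?exprn_gt0 ?normr_gt0 // ltW.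
  by rewrite !rmorphB; ring.
move: lt; rewrite -(map_mx1 rc) !quad_real ?trmx1 //.
rewrite -rmorphM ltcR mulrDr !mulmx1 ltNge => /negP; apply.
have ReM (z : R[i]) (r : R) : complex.Re (z * rc r) = complex.Re z * r.
  by case: z => x1 x2 /=; rewrite mulr0 subr0.
have ImM (z : R[i]) (r : R) : complex.Im (z * rc r) = complex.Im z * r.
  by case: z => x1 x2 /=; rewrite mulr0 add0r.
(* As [w] is real, the real and imaginary parts of [u] lie in the hyperplane separately. *)
have proj0 (h : R[i] -> R) : h 0 = 0 -> {morph h : x y / x + y} ->
    (forall z r, h (z * rc r) = h z * r) -> map_mx h u *m w = 0.
  move=> h0 hD hM; apply/matrixP => k l.
  have := congr1 (fun M : 'M[R[i]]_1 => h (M k l)) uw.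
  rewrite !mxE h0 (big_morph h hD h0) => e.
  by rewrite -[RHS]e; apply: eq_bigr => m _; rewrite !mxE hM.
apply: lerD; apply: tP; apply: proj0 => //; by case=> ? ? [].
Qed.
End Spectral.

(** * The Dirichlet form of the Laplacian *)

Lemma sum_enum_val (V : nmodType) (T : finType) (F : T -> V) :
  \sum_x F x = \sum_(i < #|T|) F (enum_val i).
Proof. by rewrite (reindex _ (onW_bij _ (@enum_val_bij T))). Qed.

Section Laplacian.
Variables (R : rcfType) (T : finType) (e : rel T).
Hypothesis e_sym : symmetric e.

Lemma laplacian_sym : (laplacian e R)^T = laplacian e R.
Proof.
apply/matrixP => i j; rewrite !mxE e_sym [j == i]eq_sym.
by have [->|] := eqVneq i j.
Qed.

(** Each edge is counted in both orientations, hence the division by 2. *)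
Definition dirichlet (x : T -> R) : R :=
  (\sum_u \sum_v (e u v)%:R * (x u - x v) ^+ 2) / 2.

Lemma laplacian_quad (x : T -> R) (r := \row_i x (enum_val i)) :
  (r *m laplacian e R *m r^T) 0 0 = dirichlet x.
Proof.
have degE u : (degree e u)%:R = \sum_v (e u v)%:R :> R.
  rewrite -natr_sum; congr _%:R; rewrite /degree -sum1_card big_mkcond /=.
  by apply: eq_bigr => v _; rewrite inE; case: (e u v).
have -> : (r *m laplacian e R *m r^T) 0 0 =
    \sum_u x u * ((degree e u)%:R * x u) - \sum_u \sum_v x u * ((e u v)%:R * x v).
  rewrite -mulmxA mulmxBl mulmxBr mul_diag_mx [LHS]mxE [X in _ + X]mxE.
  congr (_ - _).
    by rewrite mxE [RHS]sum_enum_val; apply: eq_bigr => i _; rewrite !mxE.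
  rewrite mxE [RHS]sum_enum_val; apply: eq_bigr => i _; rewrite !mxE mulr_sumr.
  by rewrite [RHS]sum_enum_val; apply: eq_bigr => j _; rewrite !mxE.
pose S1 := \sum_u \sum_v (e u v)%:R * x u ^+ 2.
pose S2 := \sum_u \sum_v (e u v)%:R * x v ^+ 2.
pose S3 := \sum_u \sum_v x u * ((e u v)%:R * x v).
have S12 : S1 = S2.
  rewrite /S2 exchange_big; apply: eq_bigr => u _; apply: eq_bigr => v _.
  by rewrite e_sym.
have -> : dirichlet x = (S1 + S2 - 2 * S3) / 2.
  congr (_ / _); rewrite mulr_sumr -big_split -sumrB /=; apply: eq_bigr => u _.
  rewrite mulr_sumr -big_split -sumrB /=; apply: eq_bigr => v _; ring.
have -> : \sum_u x u * ((degree e u)%:R * x u) = S1.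
  apply: eq_bigr => u _; rewrite degE mulr_suml mulr_sumr.
  by apply: eq_bigr => v _; ring.
by rewrite -S12 -/S3; field.
Qed.

Lemma lambda2_ge (t : R) (w : T -> R) : (1 < #|T|)%N ->
    (forall x : T -> R, \sum_v x v * w v = 0 ->
       t * (\sum_v x v ^+ 2) <= dirichlet x) ->
  t <= lambda e R 2.
Proof.
move=> T2 tP; pose wv : 'cV[R]_#|T| := \col_i w (enum_val i).
apply: (second_eigenvalue_ge (w := wv)) T2 laplacian_sym _ => r /matrixP/(_ 0 0).
pose x v := r 0 (enum_rank v).
have -> : r = \row_i x (enum_val i).
  by apply/rowP => i; rewrite mxE /x enum_valK.
rewrite laplacian_quad !mxE => rw.
have <- : \sum_v x v ^+ 2 =
      \sum_(j < #|T|) (\row_i x (enum_val i)) 0 j * (\row_i x (enum_val i))^T j 0.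
  by rewrite [LHS]sum_enum_val; apply: eq_bigr => v _; rewrite !mxE expr2.
apply: tP; rewrite -[RHS]rw [LHS]sum_enum_val.
by apply: eq_bigr => v _; rewrite !mxE.
Qed.

End Laplacian.

(** * Rooted trees of depth at most 2: sums over vertices and edges *)

Section Depth2.
Variables (T : finType) (e : rel T) (c : T) (p : T -> T).

Definition children v := [set l | (l != c) && (p l == v)].

(* c is the root and p the parent map; the value p c is irrelevant. *)
Definition rooted2 :=
  (forall x y, e x y = (x != c) && (y == p x) || (y != c) && (x == p y)) /\
  (forall x, x != c -> p x != c -> p (p x) = c).

Hypothesis rT : rooted2.

(** Each vertex is the root, a child of it, or a grandchild, grouped under its parent. *)
Lemma sum_rooted2 (V : nmodType) (F : T -> V) :
  \sum_x F x =
    F c + \sum_(v in children c) (F v + \sum_(l in children v) F l).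
Proof.
rewrite (bigD1 c) //=; congr (_ + _).
rewrite big_split /= (bigID (fun x => p x == c)) /=; congr (_ + _).
  by apply: eq_bigl => x; rewrite inE.
rewrite (partition_big p (mem (children c))) /=; last first.
  move=> x /andP[xc pxc]; rewrite inE pxc; apply/eqP.
  by case: rT => _; apply.
apply: eq_bigr => v; rewrite inE => /andP[vc _]; apply: eq_bigl => l.
by rewrite inE; have [->|] := eqVneq (p l) v; rewrite ?andbF // vc !andbT.
Qed.

Lemma dirichlet_rooted2 (R : rcfType) (x : T -> R) :
  dirichlet e x = \sum_(u | u != c) (x u - x (p u)) ^+ 2.
Proof.
have [eE pE] := rT.
pose S := \sum_(u | u != c) (x u - x (p u)) ^+ 2.
rewrite /dirichlet.
have -> : \sum_u \sum_v (e u v)%:R * (x u - x v) ^+ 2 = S + S.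
  have aux : \sum_u \sum_v ((u != c) && (v == p u))%:R * (x u - x v) ^+ 2 = S.
    rewrite /S [RHS]big_mkcond /=; apply: eq_bigr => u _; rewrite (bigD1 (p u)) //= eqxx.
    rewrite andbT big1 => [|v /negPf->]; last by rewrite andbF mul0r.
    by case: ifP => _; rewrite addr0 ?mul1r ?mul0r.
  rewrite -{1}aux -aux [X in _ = _ + X]exchange_big -big_split /=.
  apply: eq_bigr => u _; rewrite -big_split /=; apply: eq_bigr => v _.
  rewrite -[(x v - x u) ^+ 2]sqrrN opprB -mulrDl eE -natrD; congr (_%:R * _).
  case: (boolP (_ && _)) => [/andP[uc /eqP vE]|] //=.
  case: (boolP (_ && _)) => [/andP[vc /eqP uE]|] //=.
  (* If [u] and [v] were each the parent of the other, then [p (p u)] would be [u] and not the root;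
     so the two disjuncts of [eE] exclude each other. *)
  have : p (p u) = c by apply: pE; rewrite -?vE.
  by rewrite -vE -uE => /eqP; rewrite (negPf uc).
by rewrite -/S; field.
Qed.

End Depth2.

(** * Trees of depth at most 2 *)

Section Weights.
Variables (R : rcfType) (T : finType) (e : rel T) (c : T) (p : T -> T).
Hypotheses (e_sym : symmetric e) (rT : rooted2 e c p) (T2 : (1 < #|T|)%N).
Variable t : R.
Hypothesis t1 : t < 1.

(** This is g_v: t for [v] itself, and for each child of [v] the loss t / (1 - t) left after
    minimising over the value there. *)
Definition weight (v : T) : R := t + #|children c p v|%:R * (t / (1 - t)).

(* The contribution of the leaves below v is bounded by minimising over their
   values, the minimum being at x v / (1 - t). *)
Lemma dirichlet_ge (x : T -> R) :
  \sum_(v in children c p c) ((x v - x c) ^+ 2 - weight v * x v ^+ 2)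
    - t * x c ^+ 2 <= dirichlet e x - t * \sum_v x v ^+ 2.
Proof.
have t1' : 0 < 1 - t by rewrite subr_gt0.
rewrite (dirichlet_rooted2 rT) [X in _ <= X - _]big_mkcond mulr_sumr -sumrB (sum_rooted2 rT) /= eqxx /=.
rewrite sub0r addrC lerD2r; apply: ler_sum => v; rewrite inE => /andP[vc /eqP pv].
rewrite vc pv /weight.
have -> : (x v - x c) ^+ 2 - (t + #|children c p v|%:R * (t / (1 - t))) * x v ^+ 2
  = (x v - x c) ^+ 2 - t * x v ^+ 2 +
    \sum_(l in children c p v) - (t / (1 - t) * x v ^+ 2).
  by rewrite sumr_const -mulr_natl; ring.
rewrite lerD2l; apply: ler_sum => l; rewrite inE => /andP[lc /eqP->]; rewrite lc.
rewrite -subr_ge0.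
have -> : (x l - x v) ^+ 2 - t * x l ^+ 2 - - (t / (1 - t) * x v ^+ 2) =
  (1 - t) * (x l - x v / (1 - t)) ^+ 2 by field; lra.
by rewrite mulr_ge0 ?sqr_ge0 // ltW.
Qed.

(** With x_c = 0 the term of [v] becomes (1 - g_v) x_v^2. *)
Lemma lambda2_ge_light :
  (forall v, v \in children c p c -> weight v <= 1) -> t <= lambda e R 2.
Proof.
move=> w1; apply: (lambda2_ge e_sym (w := fun v => (v == c)%:R)) => // x.
rewrite (bigD1 c) //= eqxx mulr1 big1 ?addr0 => [xc0|v /negPf->]; last by rewrite mulr0.
rewrite -subr_ge0; apply: le_trans (dirichlet_ge x).
rewrite xc0 expr0n mulr0 subr0; apply: sumr_ge0 => v /w1 wv.
by rewrite subr0 -[X in X - _]mul1r -mulrBl mulr_ge0 ?sqr_ge0 // subr_ge0.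
Qed.

(** Minimising over x_v for [v != v1] costs g_v / (1 - g_v) x_c^2, and the root costs t x_c^2. On
    the hyperplane, the term of [v1] is g / (g - 1) x_c^2 with g = [weight v1]; the inequality
    assumed says that it covers these costs. *)
Lemma lambda2_ge_heavy v1 : v1 \in children c p c -> 1 < weight v1 ->
    (forall v, v \in children c p c -> v != v1 -> weight v < 1) ->
    t + \sum_(v in children c p c | v != v1) weight v / (1 - weight v)
      <= weight v1 / (weight v1 - 1) ->
  t <= lambda e R 2.
Proof.
move=> v1N w1 wv Hsum.
(* This hyperplane is orthogonal, for the form bounded below by [dirichlet_ge],
   to the negative direction carried by v1. *)
pose phi v : R := (v == c)%:R - (1 - weight v1) * (v == v1)%:R.
apply: (lambda2_ge e_sym (w := phi)) => // x xphi.
have delta u : \sum_v x v * (v == u)%:R = x u.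
  rewrite (bigD1 u) //= eqxx mulr1 big1 ?addr0 // => v /negPf->.
  by rewrite mulr0.
have {xphi} xcE : x c = (1 - weight v1) * x v1.
  apply/eqP; rewrite -subr_eq0 -xphi -{1}[x c]delta -{1}[x v1]delta mulr_sumr -sumrB.
  by apply/eqP; apply: eq_bigr => v _; rewrite /phi; ring.
rewrite -subr_ge0; apply: le_trans (dirichlet_ge x).
rewrite (bigD1 v1) //=.
set S := \sum_(v in _ | _) (_ - _); set h := \sum_(v in _ | _) _ in Hsum.
have SP : - (h * x c ^+ 2) <= S.
  rewrite /h mulr_suml -sumrN; apply: ler_sum => v /andP[vN vv1].
  have wv1 : 0 < 1 - weight v by rewrite subr_gt0 wv.
  rewrite -subr_ge0.
  have -> : (x v - x c) ^+ 2 - weight v * x v ^+ 2 - - (weight v / (1 - weight v) * x c ^+ 2)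
     = (1 - weight v) * (x v - x c / (1 - weight v)) ^+ 2 by field; lra.
  by rewrite mulr_ge0 ?sqr_ge0 // ltW.
set g := weight v1 in w1 xcE Hsum *.
have g1 : 0 < g - 1 by lra.
have : (t + h) * x c ^+ 2 <= g / (g - 1) * x c ^+ 2 by rewrite ler_wpM2r ?sqr_ge0.
have -> : g / (g - 1) * x c ^+ 2 = (x v1 - x c) ^+ 2 - g * x v1 ^+ 2.
  by rewrite xcE; field; lra.
by rewrite mulrDl; lra.
Qed.

Let a v : R := #|children c p v|%:R.

Lemma card_rooted2 : #|T|%:R = 1 + \sum_(v in children c p c) (1 + a v) :> R.
Proof.
have := sum_rooted2 rT (fun=> 1 : R); rewrite sumr_const => ->; congr (1 + _).
by apply: eq_bigr => v _; rewrite sumr_const.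
Qed.

(** The equation reads t M = (1 - t)^2, so a child [v] has weight above 1 exactly when [a v > M].
    The branches at the root have 2 M vertices in total, so this happens for at most one of them. *)
Lemma lambda2_ge_depth2 : 0 < t ->
  t ^+ 2 - ((#|T|%:R + 3) / 2) * t + 1 = 0 -> t <= lambda e R 2.
Proof.
move=> tp tE; pose M : R := (#|T|%:R - 1) / 2.
have t1' : 0 < 1 - t by rewrite subr_gt0.
have tM : t * M = (1 - t) ^+ 2 by rewrite /M; lra.
have wE v : 1 - weight v = t * (M - a v) / (1 - t).
  apply: (mulIf (lt0r_neq0 t1')); rewrite divfK ?lt0r_neq0 // [RHS]mulrBr tM /weight -/(a v).
  by field; lra.
have wD v : weight v = t * (1 - t + a v) / (1 - t).
  by rewrite /weight -/(a v); field; lra.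
have [/forall_inP w1|] := boolP [forall v in children c p c, weight v <= 1].
  exact: lambda2_ge_light.
case/forall_inPn => v1 v1N; rewrite -ltNge => w1.
have nE := card_rooted2; rewrite (bigD1 v1) //= in nE.
set r := \sum_(v in _ | _) _ in nE.
pose d := a v1 - M.
have d0 : 0 < d.
  have : t * (M - a v1) / (1 - t) < 0 by rewrite -wE; lra.
  rewrite ltr_pdivrMr // mul0r pmulr_rlt0 // /d; lra.
have nM : #|T|%:R = 2 * M + 1 by rewrite /M; lra.
have rd : r = M - 1 - d by rewrite /d; lra.
(* The branches other than that of [v1] have r = M - 1 - d vertices together, which bounds each of
   them. *)
have av v : v \in children c p c -> v != v1 -> d + 2 <= M - a v.
  move=> vN vv1; suff : 1 + a v <= r by lra.
  rewrite /r (bigD1 v) /= ?vN //= lerDl sumr_ge0 // => u _.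
  by rewrite addr_ge0 // /a ler0n.
apply: (lambda2_ge_heavy v1N w1) => [v vN vv1|].
  rewrite -subr_gt0 wE divr_gt0 // mulr_gt0 //; have := av v vN vv1; lra.
have -> : weight v1 / (weight v1 - 1) = 1 + (1 - t + M) / d.
  rewrite -[weight v1 - 1]opprB wE wD /d; field.
  by rewrite /d in d0; apply/and3P; split; lra.
have : \sum_(v in children c p c | v != v1) weight v / (1 - weight v) <= r / (d + 2).
  rewrite /r mulr_suml; apply: ler_sum => v /andP[vN vv1].
  have dv := av v vN vv1.
  have -> : weight v / (1 - weight v) = (1 - t + a v) / (M - a v).
    by rewrite wE wD; field; apply/and3P; split; lra.
  rewrite ler_pM //.
  - by have : 0 <= a v := ler0n _ _; lra.
  - by rewrite invr_ge0; lra.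
  - by lra.
  - by rewrite lef_pV2 ?posrE; lra.
move/(lerD (lexx t))/le_trans; apply; apply: lerD; first lra.
rewrite ler_pdivrMr; last lra.
have M0 : 0 <= M.
  have : 0 <= t * M by rewrite tM sqr_ge0.
  by rewrite pmulr_rge0.
have : 0 <= (1 - t + M) / d by rewrite divr_ge0; lra.
have : (1 - t + M) / d * d = 1 - t + M by rewrite divfK //; lra.
nra.
Qed.

(** Children other than [v1] have weight t < 1. If g = [weight v1] exceeds 1, the condition of
    [lambda2_ge_heavy] becomes 4 - g <= g / (g - 1), that is, (g - 2)^2 >= 0. *)
Lemma lambda2_ge_double_star v1 : v1 \in children c p c ->
    (forall v, v \in children c p c -> v != v1 -> children c p v = set0) ->
  t ^+ 2 - (#|T|%:R / 2 + 2) * t + 2 = 0 -> t <= lambda e R 2.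
Proof.
move=> v1N leaf tE.
have t1' : 0 < 1 - t by rewrite subr_gt0.
have wl v : v \in children c p c -> v != v1 -> weight v = t.
  by move=> vN vv1; rewrite /weight leaf // cards0 mul0r addr0.
have [w1|w1] := leP (weight v1) 1.
  apply: lambda2_ge_light => v vN; have [->//|vv1] := eqVneq v v1.
  by rewrite wl // ltW.
apply: (lambda2_ge_heavy v1N w1) => [v vN vv1|]; first by rewrite wl.
have nE := card_rooted2; rewrite (bigD1 v1) //= in nE.
pose b : R := \sum_(v in children c p c | v != v1) 1.
have bE : \sum_(v in children c p c | v != v1) (1 + a v) = b.
  by apply: eq_bigr => v /andP[vN vv1]; rewrite /a leaf // cards0 addr0.
have -> : \sum_(v in children c p c | v != v1) weight v / (1 - weight v) = b * (t / (1 - t)).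
  by rewrite /b mulr_suml; apply: eq_bigr => v /andP[vN vv1]; rewrite wl // mul1r.
(* The equation for t makes the weights of v1 and c, the two centers, add up
   to 4, where the weight of c counts its leaves only. *)
have sumw : weight v1 + (t + b * (t / (1 - t))) = 4.
  have b2 : b = #|T|%:R - 2 - a v1 by rewrite nE bE; ring.
  rewrite b2 /weight -/(a v1); apply: (mulIf (lt0r_neq0 t1')).
  rewrite [LHS](_ : _ = 2 * t * (1 - t) + (#|T|%:R - 2) * t); last by field; lra.
  lra.
have -> : t + b * (t / (1 - t)) = 4 - weight v1 by lra.
rewrite ler_pdivlMr ?subr_gt0 // -subr_ge0.
have -> : weight v1 - (4 - weight v1) * (weight v1 - 1) = (weight v1 - 2) ^+ 2 by ring.
exact: sqr_ge0.
Qed.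

End Weights.

(** * The smaller root of a quadratic *)

Section Quadratic.
Variable R : rcfType.
Implicit Types b s y : R.

(** The quadratic is positive at 0 and negative at 1, so its smaller root lies between. *)
Lemma small_root b s : 0 < s -> s + 1 < b ->
  exists t : R, [/\ 0 < t, t < 1 & t ^+ 2 - b * t + s = 0].
Proof.
move=> s0 sb; pose r := Num.sqrt (b ^+ 2 - 4 * s).
have rr : r ^+ 2 = b ^+ 2 - 4 * s.
  rewrite sqr_sqrtr //; have := sqr_ge0 (s - 1).
  have : 0 < (b - (s + 1)) * (b + (s + 1)) by rewrite mulr_gt0; lra.
  lra.
have r0 : 0 <= r by exact: sqrtr_ge0.
exists ((b - r) / 2); split; last by lra.
  suff : r < b by lra.
  by rewrite -(ltr_pXn2r (n := 2)) ?nnegrE //; lra.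
suff : b - 2 < r by lra.
rewrite ltNge; apply/negP => rb; nra.
Qed.

(** The hypothesis bounds the discriminant below by (2 y - b)^2, so the square root is genuine and
    [y] lies between the roots. *)
Lemma lower_root_le b s y : y ^+ 2 - b * y + s <= 0 ->
  (b - Num.sqrt (b ^+ 2 - 4 * s)) / 2 <= y.
Proof.
move=> fy; set r := Num.sqrt _.
have rr : r ^+ 2 = b ^+ 2 - 4 * s.
  by rewrite sqr_sqrtr //; have := sqr_ge0 (2 * y - b); lra.
have r0 : 0 <= r by exact: sqrtr_ge0.
suff : b - 2 * y <= r by lra.
rewrite leNgt; apply/negP => rb; nra.
Qed.

End Quadratic.

(** * Short distances, short cycles and the choice of a root *)

Section Tree.
Variables (T : finType) (e : rel T).

Definition within2 x y := [|| x == y, e x y | [exists z, e x z && e z y]].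

Lemma within2_sym : symmetric e -> symmetric within2.
Proof.
move=> e_sym x y; rewrite /within2 eq_sym e_sym; congr [|| _, _ | _].
by apply: eq_existsb => z; rewrite andbC e_sym [e x z]e_sym.
Qed.

Lemma notin_Dset x v : connected_graph e -> v \notin Dset e -> within2 x v.
Proof.
move=> e_conn; rewrite inE negb_exists => /forallP/(_ x); rewrite -ltnNge /dist.
(* A walk without repeated vertices has length below [#|T|], so the search in [dist] succeeds and
   does not return its default. *)
have hasW : has (fun l => walk_of_length e l x v) (iota 0 #|T|).
  have /connectP [q qP ->] := e_conn x v; case/shortenP: qP => q' pq' uq' _.
  apply/hasP; exists (size q').
    by rewrite mem_iota /= -[(size q').+1]/(size (x :: q')) -(card_uniqP uq') max_card.
  by apply/existsP; exists (in_tuple q'); rewrite pq' eqxx.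
have := nth_find 0 hasW; move: (hasW); rewrite has_find size_iota => lt.
rewrite nth_iota // add0n; case: find => [|[|[|//]]] /existsP[q /andP[]].
- by rewrite tuple0 /= => _ xv _; rewrite /within2 xv.
- case: q => [[|y [|]]] //= _; rewrite andbT => exy /eqP <- _.
  by rewrite /within2 exy orbT.
case: q => [[|y [|z [|]]]] //= _ /and3P[exy eyz _] /eqP <- _.
by apply/or3P/Or33; apply/existsP; exists y; rewrite exy.
Qed.

Hypothesis treeG : tree e.

Lemma tree_sym : symmetric e. Proof. by case: treeG => [[]]. Qed.

Lemma tree_neq x y : e x y -> x != y.
Proof. by case: treeG => [[_ irr] _ _] exy; apply: contraTneq exy => ->; rewrite irr. Qed.

(** An extra edge between vertices within distance 2 of a root closes a cycle of length 3, 4 or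
    5. *)
Lemma no_cycle3 x y z : e x y -> e y z -> e z x -> False.
Proof.
move=> exy eyz ezx; have [_ _ /(_ [:: x; y; z] isT)] := treeG.
rewrite /ucycleb /= !inE !negb_or exy eyz ezx /= !(tree_neq exy, tree_neq eyz) /=.
by rewrite [x == z]eq_sym (tree_neq ezx).
Qed.

Lemma no_cycle4 x y z u : e x y -> e y z -> e z u -> e u x ->
  x != z -> y != u -> False.
Proof.
move=> exy eyz ezu eux xz yu; have [_ _ /(_ [:: x; y; z; u] isT)] := treeG.
rewrite /ucycleb /= !inE exy eyz ezu eux /=.
rewrite !negb_or xz yu !(tree_neq exy, tree_neq eyz, tree_neq ezu) /=.
by rewrite [x == u]eq_sym (tree_neq eux).
Qed.

Lemma no_cycle5 x y z u v : e x y -> e y z -> e z u -> e u v -> e v x ->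
  x != z -> x != u -> y != u -> y != v -> z != v -> False.
Proof.
move=> exy eyz ezu euv evx xz xu yu yv zv.
have [_ _ /(_ [:: x; y; z; u; v] isT)] := treeG.
rewrite /ucycleb /= !inE exy eyz ezu euv evx /=.
rewrite !negb_or xz xu yu yv zv.
rewrite !(tree_neq exy, tree_neq eyz, tree_neq ezu, tree_neq euv) /=.
by rewrite [x == v]eq_sym (tree_neq evx).
Qed.

Lemma rooting c : (forall x, within2 c x) -> exists p, rooted2 e c p.
Proof.
move=> near_c.
(* For [x] other than [c], the default of [odflt] is never reached, by [near_c]. *)
pose p x := if e c x then c else odflt c [pick z | e c z && e z x].
exists p.
have p1 x : e c x -> p x = c by rewrite /p => ->.
have p2 x : x != c -> ~~ e c x -> e c (p x) /\ e (p x) x.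
  move=> xc cx; rewrite /p (negPf cx); case: pickP => [z /andP[]//|none].
  have := near_c x; rewrite /within2 eq_sym (negPf xc) (negPf cx) /=.
  by case/existsP => z; rewrite none.
have pe x : x != c -> e x (p x).
  move=> xc; rewrite tree_sym; have [cx|cx] := boolP (e c x); first by rewrite p1.
  by case: (p2 x xc cx).
split=> [x y|x xc pxc]; last first.
  have [cx|cx] := boolP (e c x); first by rewrite p1 ?eqxx in pxc.
  by case: (p2 x xc cx) => /p1.
apply/idP/idP => [exy|/orP[/andP[xc /eqP->]|/andP[yc /eqP->]]]; last 2 first.
- exact: pe.
- by rewrite tree_sym pe.
have [xc|xc] := eqVneq x c.
  by move: exy; rewrite xc => cy; rewrite (p1 y) // [y == c]eq_sym (tree_neq cy) !eqxx.
have [yc|yc] := eqVneq y c.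
  by move: exy; rewrite yc tree_sym => cx; rewrite (p1 x) // !eqxx.
have eyx : e y x by rewrite tree_sym.
(* An edge between levels 1 and 2 joins child and parent; otherwise it closes a 4-cycle through [c]
   and [p v]. *)
have half u v : u != c -> v != c -> e u v -> e c u -> ~~ e c v -> u = p v.
  move=> uc vc euv cu ncv; have [cz ezv] := p2 v vc ncv.
  apply/eqP; apply: contraT => uz; exfalso.
  apply: (no_cycle4 (x := c) (y := u) (z := v) (u := p v)) => //.
  - by rewrite tree_sym.
  - by rewrite tree_sym.
  - by rewrite eq_sym.
have [cx|cx] := boolP (e c x); have [cy|cy] := boolP (e c y) => /=.
- by exfalso; apply: (no_cycle3 cx exy); rewrite tree_sym.
- by rewrite -(half x y) // eqxx orbT.
- by rewrite -(half y x) // eqxx.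
(* Two adjacent vertices of level 2 give a triangle if they share a parent, and a 5-cycle through
   [c] if not. *)
have [cu eux] := p2 x xc cx; have [cv evy] := p2 y yc cy.
exfalso; have [puv|puv] := eqVneq (p x) (p y).
  by apply: (no_cycle3 eux exy); rewrite tree_sym puv.
have eyv : e y (p y) by rewrite tree_sym.
have evc : e (p y) c by rewrite tree_sym.
apply: (no_cycle5 cu eux exy eyv evc) => //; try by rewrite eq_sym.
- by apply: contraNneq cy => <-.
- by apply: contraNneq cx => ->.
Qed.

Section Rooted.
Variables (c : T) (p : T -> T).
Hypothesis rT : rooted2 e c p.

Lemma mem_children_root v : (v \in children c p c) = e c v.
Proof. by rewrite (proj1 rT) eqxx inE /= [c == _]eq_sym. Qed.

(** A vertex of depth 2 is a leaf, so every walk leaving it passes through its parent; [x = l]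
    counts as a neighbour of [p l]. *)
Lemma within2_depth2 l x : l != c -> p l != c -> within2 l x ->
  (x == p l) || e (p l) x.
Proof.
have [eE pp] := rT => lc plc.
have nbr z : e l z -> z = p l.
  rewrite eE lc /= => /orP[/eqP//|/andP[zc /eqP lE]].
  by case/eqP: plc; rewrite lE pp -?lE.
case/or3P => [/eqP<-|/nbr->|/existsP[z /andP[/nbr-> ->]]]; rewrite ?eqxx ?orbT //.
by rewrite eE lc eqxx /= !orbT.
Qed.

Lemma adj_child v x : v \in children c p c -> e v x ->
  (x == c) || (x != c) && (p x == v).
Proof.
rewrite inE => /andP[vc /eqP pv]; rewrite (proj1 rT) vc pv /=.
by case/orP => [->//|/andP[xc /eqP<-]]; rewrite xc eqxx orbT.
Qed.

End Rooted.
End Tree.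

(** * Case analysis on the shape of the tree *)

Section Bound.
Variables (R : rcfType) (T : finType) (e : rel T).
Hypotheses (treeG : tree e) (T2 : (1 < #|T|)%N).

Lemma lambda2_ge0 : 0 <= lambda e R 2.
Proof.
(* With zero coefficients the constraint is void: the form is nonnegative everywhere. *)
apply: (lambda2_ge (tree_sym treeG) (w := fun=> 0)) => // x _.
rewrite mul0r divr_ge0 // sumr_ge0 // => u _; rewrite sumr_ge0 // => v _.
by rewrite mulr_ge0 ?ler0n ?sqr_ge0.
Qed.

(** Stars need t = 1, where the weights would divide by 0. On x_c = 0 the form is exactly |x|^2. *)
Lemma lambda2_star c : (forall x, x != c -> e c x) -> 1 <= lambda e R 2.
Proof.
move=> star; have [|p rT] := rooting treeG (c := c).
  move=> x; rewrite /within2 eq_sym; have [//|xc] := eqVneq x c.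
  by rewrite star.
apply: (lambda2_ge (tree_sym treeG) (w := fun v => (v == c)%:R)) => // x.
rewrite (bigD1 c) //= eqxx mulr1 big1 ?addr0 => [xc0|v /negPf->]; last by rewrite mulr0.
rewrite mul1r (dirichlet_rooted2 rT) (bigD1 c) //= xc0 expr0n add0r.
apply: ler_sum => v vc; have := star v vc.
by rewrite -(mem_children_root rT) inE vc => /eqP ->; rewrite xc0 subr0.
Qed.

Lemma lambda2_tree_ge (s : R) (S := ~: Dset e) (n : R := #|T|%:R) : s = #|S|%:R ->
  exists2 t : R, t ^+ 2 - ((n + s) / 2 + 1) * t + s <= 0 & t <= lambda e R 2.
Proof.
move=> sE; have e_sym := tree_sym treeG.
have e_conn : connected_graph e by case: treeG.
have sn : s <= n by rewrite sE ler_nat max_card.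
have n2 : 2 <= n by rewrite ler_nat.
have nearS x v : v \in S -> within2 e v x.
  by rewrite inE within2_sym // => vD; apply: notin_Dset.
have star c : (forall x, x != c -> e c x) ->
    exists2 t : R, t ^+ 2 - ((n + s) / 2 + 1) * t + s <= 0 & t <= lambda e R 2.
  (* At t = 1 the quadratic equals (s - n) / 2. *)
  by move=> cP; exists 1; [lra | exact: lambda2_star cP].
have [S0|[c cS]] := set_0Vmem S.
  by exists 0; [rewrite sE S0 cards0; lra | exact: lambda2_ge0].
have [p rT] := rooting treeG (fun x => nearS x c cS).
have [eE pp] := rT.
have [/forall_inP cP|] := boolP [forall x in [pred x | x != c], e c x].
  exact: (star c).
case/forall_inPn => l; rewrite inE => lc ncl.
have plc : p l != c.
  by apply: contra ncl => /eqP plc; rewrite -(mem_children_root rT) inE lc plc eqxx.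
pose v1 := p l; have v1N : v1 \in children c p c.
  by rewrite inE plc pp ?eqxx.
have Sv1 x : x \in S -> [|| x == v1, x == c | (x != c) && (p x == v1)].
  move=> xS; have := within2_depth2 rT lc plc; rewrite -/v1 => /(_ x).
  rewrite within2_sym // => /(_ (nearS l x xS)) /orP[->//|].
  by move/(adj_child rT v1N)/orP => [|] ->; rewrite ?orbT.
(* If a second branch also has depth 2, a vertex of [S] is near the leaves [l] and [m], hence equal
   or adjacent to each of [v1] and [v2]; only [c] qualifies. *)
have [/exists_inP[v2 v2N /andP[v21 /set0Pn[m]]]|] :=
  boolP [exists v2 in children c p c, (v2 != v1) && (children c p v2 != set0)].
  rewrite inE => /andP[mc /eqP pm].
  have [v2c pv2] : v2 != c /\ p v2 = c by move: v2N; rewrite inE => /andP[? /eqP].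
  have pv1 : p v1 = c by move: v1N; rewrite inE => /andP[_ /eqP].
  have Sc x : x \in S -> x = c.
    move=> xS; apply/eqP; apply: contraT => xc.
    have := within2_depth2 rT mc; rewrite pm => /(_ x v2c).
    rewrite within2_sym // => /(_ (nearS m x xS)).
    have /or3P[/eqP->|xc'|/andP[_ /eqP px]] := Sv1 x xS; last 2 first.
    - by rewrite xc' in xc.
    - case/orP => [/eqP xv2|/(adj_child rT v2N)].
        by move: px plc; rewrite xv2 pv2 -/v1 => <-; rewrite eqxx.
      by rewrite (negPf xc) px /= => /eqP v12; rewrite v12 eqxx in v21.
    rewrite eq_sym (negPf v21) /= => /(adj_child rT v2N).
    by rewrite -/v1 in plc; rewrite (negPf plc) pv1 eq_sym (negPf v2c) andbF.
  have s1 : s <= 1.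
    rewrite sE (_ : 1 = 1%:R) // ler_nat -(cards1 c) subset_leq_card //.
    by apply/subsetP => x /Sc ->; rewrite inE.
  have [] := @small_root R ((n + 3) / 2) 1; [lra|lra|] => t [t0 t1 tE].
  exists t; last by apply: (lambda2_ge_depth2 e_sym rT T2 t1 t0).
  (* This product is the value at t of the quadratic for s = 1 minus that for the actual [s]. *)
  have : 0 <= (1 - s) * (1 - t / 2) by rewrite mulr_ge0; lra.
  lra.
move=> noleaf.
have leaf v : v \in children c p c -> v != v1 -> children c p v = set0.
  move=> vN vv1; apply/eqP; apply: contraNT noleaf => chv.
  by apply/exists_inP; exists v; rewrite // vv1.
(* All grandchildren now hang below [v1]. A further child [u] of [c] is at distance 3 from each of
   them, which leaves only [c] and [v1] for [S]. *)
have [/exists_inP[u uN uv1]|one] := boolP [exists u in children c p c, u != v1].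
  have [uc pu] : u != c /\ p u = c by move: uN; rewrite inE => /andP[? /eqP].
  have s2 : s <= 2.
    rewrite sE ler_nat (@leq_trans #|[set c; v1]|) //; last first.
      by rewrite cards2; case: (_ == _).
    rewrite subset_leq_card //; apply/subsetP => x xS; rewrite !inE.
    have /or3P[->|->//|/andP[xc /eqP px]] := Sv1 x xS; first by rewrite orbT.
    have := within2_depth2 rT xc; rewrite px => /(_ u plc (nearS u x xS)).
    rewrite (negPf uv1) /= => /(adj_child rT v1N).
    by rewrite (negPf uc) pu eq_sym (negPf plc).
  have n3 : 3 <= n.
    rewrite ler_nat -[3%N]/(size [:: c; v1; u]).
    rewrite -(card_uniqP _) ?max_card //= !inE !negb_or.
    by rewrite [c == v1]eq_sym [c == u]eq_sym plc uc eq_sym uv1.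
  have [] := @small_root R (n / 2 + 2) 2; [lra|lra|] => t [t0 t1 tE].
  exists t; last by apply: (lambda2_ge_double_star e_sym rT T2 t1 v1N leaf).
  have : 0 <= (2 - s) * (1 - t / 2) by rewrite mulr_ge0; lra.
  lra.
have only v : v \in children c p c -> v = v1.
  move=> vN; apply/eqP; apply: contraNT one => vv1.
  by apply/exists_inP; exists v.
(* With [v1] the only child of [c], the tree is a star centered at [v1]. *)
apply: (star v1) => x xv1; rewrite eE plc.
have [->|xc] := eqVneq x c; first by rewrite pp ?eqxx.
have [px|px] := eqVneq (p x) c.
  by rewrite (only x) ?eqxx // in xv1; rewrite inE xc px eqxx.
by rewrite (only (p x)) ?eqxx ?orbT // inE px pp ?eqxx.
Qed.

End Bound.

Theorem theorem3p11 (R : rcfType) (T : finType) (e : rel T)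
    (treeG : tree e) (n_ge2 : (2 <= #|T|)%N) :
  let n : R := #|T|%:R in
  let k : R := #|Dset e|%:R / 2 in
  (n - k + 1 - Num.sqrt ((n - k + 1) ^+ 2 - 4 * (n - 2 * k))) / 2
    <= lambda e R 2.
Proof.
cbv zeta; set n : R := #|T|%:R; set k : R := #|Dset e|%:R / 2.
have [t ft] := @lambda2_tree_ge R T e treeG n_ge2 _ (erefl _).
apply: le_trans; apply: lower_root_le.
(* For s = n - 2 k, the coefficient (n + s) / 2 + 1 is n - k + 1. *)
have sE : #|~: Dset e|%:R = n - 2 * k.
  have -> : 2 * k = #|Dset e|%:R by rewrite /k; lra.
  by rewrite /n -(cardsC (Dset e)) natrD addrAC subrr add0r.
move: ft; rewrite sE -/n; lra.
Qed.
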